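(* Let $\mathcal Y=\mathbb C$ and let $$M(t)=\sum_{i=1}^Nw_i\,\mathcal B_0\bigl(K_{0i}\mathcal S_i(t)\psi_i\bigr),\qquad t\ge0,$$ be the mixture observable. Assume each $\psi_i$ ($1\le i\le N$) has finite spectral support. Then there are finitely many pairs $(\mu_\ell,a_\ell)$, $\ell=1,\dots,L$, with $\mu_\ell>0$ and $a_\ell\in\mathbb C$, such that $$M(t)=\sum_{\ell=1}^La_\ell e^{-\mu_\ell t}\qquad\text{for all }t\ge0,$$ and, after merging equal rates, the exponents $\mu_\ell$ may be taken pairwise distinct.
   Context: Setting. $I$ is an index set. For each $i\in I$: $\mathcal H_i$ is a separable complex Hilbert space; $A_i$ is a positive self-adjoint operator on $\mathcal H_i$ with compact resolvent, whose spectrum contains at least one strictly positive eigenvalue; $\mathcal S_i(t)=e^{-tA_i}$, $t\ge0$. Bounded injective operators $K_{ij}:\mathcal H_j\to\mathcal H_i$ ($i,j\in I$) and numbers $\lambda_{ij}>0$ satisfy, for all $i,j,k\in I$, $K_{ik}=K_{ij}K_{jk}$ and $K_{ij}\mathcal S_j(t)=\mathcal S_i(\lambda_{ij}t)K_{ij}$ for all $t\ge0$. $0\in I$ is a fixed reference index and $1,\dots,N$ are distinct elements of $I$ (the reference index may coincide with one of them). $\mathcal B_0:\mathcal H_0\to\mathcal Y$ is a bounded linear operator; for $i=1,\dots,N$, $\psi_i\in\mathcal H_i$, $w_i>0$, and $A_i$ has an orthonormal eigenbasis $(\phi_{i,n})_{n\ge1}$ with eigenvalues $\alpha_{i,n}>0$,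 $\alpha_{i,n}\to\infty$. ''Finite spectral support'' means that $\psi_i$ is a finite linear combination of eigenvectors of $A_i$. *)

(* Defs.v *)
From HB Require Import structures.
From mathcomp Require Import all_boot all_order all_algebra.
From mathcomp Require Import sesquilinear.
From mathcomp Require Import all_classical all_reals all_analysis.
From mathcomp Require Import complex.

Set Implicit Arguments.
Unset Strict Implicit.
Unset Printing Implicit Defensive.

Import Order.TTheory GRing.Theory Num.Theory.
Import numFieldNormedType.Exports.

Local Open Scope classical_set_scope.
Local Open Scope ring_scope.
Local Open Scope complex_scope.

(* The inner product [x, y] |-> hdot H x y is linear in x and conjugate-linear
   in y; the norm of H takes its values in the reals of R[i]. *)
Record hilbertSpace (R : realType) := HilbertSpace {
  hcarrier :> completeNormedModType R[i];
  hdot : {dot hcarrier for Num.conj};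
  hdot_norm : forall x : hcarrier, hdot x x = `|x| ^+ 2 }.

Definition separable (T : topologicalType) : Prop :=
  exists D : set T, countable D /\ dense D.

Definition bounded_operator (R : realType) (V W : normedModType R[i])
    (T : V -> W) : Prop :=
  exists M : R, forall x : V, `|T x| <= M%:C * `|x|.

Definition compact_operator (R : realType) (V W : normedModType R[i])
    (T : V -> W) : Prop :=
  precompact (T @` [set x : V | `|x| <= 1]).

Section UnboundedOperators.
Context {R : realType} {H : hilbertSpace R}.

(* Only the values of [op_fun] on the subspace [op_dom] are meaningful. *)
Record unbounded_operator := UnboundedOperator {
  op_dom : set H;
  op_fun :> H -> H;
  op_dom0 : op_dom 0;
  op_domP : forall (a : R[i]) (x y : H),
    op_dom x -> op_dom y -> op_dom (a *: x + y);
  op_linear : forall (a : R[i]) (x y : H),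
    op_dom x -> op_dom y -> op_fun (a *: x + y) = a *: op_fun x + op_fun y }.

Implicit Types A : unbounded_operator.

(* [adjoint_graph A y z] : y is in the domain of A^* and A^* y = z (this
   relation is functional when A is densely defined). *)
Definition adjoint_graph A (y z : H) : Prop :=
  forall x : H, op_dom A x -> hdot H (A x) y = hdot H x z.

Definition self_adjoint A : Prop :=
  dense (op_dom A) /\
  forall y z : H, adjoint_graph A y z <-> (op_dom A y /\ A y = z).

Definition positive_operator A : Prop :=
  forall x : H, op_dom A x -> 0 <= hdot H (A x) x.

(* T = (A - z)^-1, as an everywhere defined operator *)
Definition resolvent_at A (z : R[i]) (T : H -> H) : Prop :=
  (forall y : H, op_dom A (T y) /\ A (T y) - z *: T y = y) /\
  (forall x : H, op_dom A x -> T (A x - z *: x) = x).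

Definition has_compact_resolvent A : Prop :=
  exists (z : R[i]) (T : H -> H),
    [/\ resolvent_at A z T, bounded_operator T & compact_operator T].

Definition eigenvector A (z : R[i]) (x : H) : Prop :=
  [/\ op_dom A x, x != 0 & A x = z *: x].

(* S(t) = e^{-tA} for t >= 0: S is the strongly continuous one-parameter
   semigroup of bounded operators whose infinitesimal generator is -A. Values
   of S at negative times are irrelevant. *)
Definition is_exp_semigroup A (S : R -> {linear H -> H}) : Prop :=
  [/\ forall t : R, 0 <= t -> bounded_operator (S t),
      forall x : H, S 0 x = x,
      forall (s t : R) (x : H), 0 <= s -> 0 <= t ->
        S (s + t) x = S s (S t x),
      forall x : H, S h x @[h --> 0^'+] --> x
    & forall x y : H,
        ((h^-1)%:C *: (S h x - x) @[h --> 0^'+] --> y) <->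
        (op_dom A x /\ - A x = y)].

Definition orthonormal_basis (phi : nat -> H) : Prop :=
  (forall m n : nat, hdot H (phi m) (phi n) = (m == n)%:R) /\
  forall x : H, \sum_(0 <= n < m) hdot H x (phi n) *: phi n @[m --> \oo] --> x.

Definition orthonormal_eigenbasis A (phi : nat -> H) (alpha : nat -> R) : Prop :=
  orthonormal_basis phi /\ forall n : nat, eigenvector A (alpha n)%:C (phi n).

Definition finite_spectral_support A (psi : H) : Prop :=
  exists (m : nat) (c z : 'I_m -> R[i]) (v : 'I_m -> H),
    (forall k : 'I_m, eigenvector A (z k) (v k)) /\
    psi = \sum_(k < m) c k *: v k.

End UnboundedOperators.

Arguments unbounded_operator {R} H.

Definition mixture (R : realType) (I : Type) (H : I -> hilbertSpace R)
    (S : forall i : I, R -> {linear H i -> H i})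
    (K : forall i j : I, {linear H j -> H i})
    (o : I) (Y : lmodType R[i]) (B0 : {linear H o -> Y})
    (N : nat) (idx : 'I_N -> I)
    (psi : forall k : 'I_N, H (idx k)) (w : 'I_N -> R) (t : R) : Y :=
  \sum_(k < N) (w k)%:C *: B0 (K o (idx k) (S (idx k) t (psi k))).

(* Main.v *)
Require Import Defs.
From mathcomp Require Import all_boot all_order all_algebra.
From mathcomp Require Import sesquilinear.
From mathcomp Require Import all_classical all_reals all_analysis.
From mathcomp Require Import complex.
Import Order.TTheory GRing.Theory Num.Theory.
Import numFieldNormedType.Exports.
Local Open Scope classical_set_scope.
Local Open Scope ring_scope.
Local Open Scope complex_scope.

(* An eigenvalue of A_i must be one of the alpha_{i,n}: otherwise, by self-adjointness,
   the eigenvector is orthogonal to the eigenbasis, hence zero. As alpha_{i,n} tends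
   to infinity, the eigenspaces are finite dimensional, so strong continuity of the
   semigroup at 0 makes it uniformly bounded near 0 on each eigenspace; telescoping
   S(t)x - e^{-bt}x over n steps of length t/n then yields S(t)x = e^{-bt}x. Hence
   every term of the mixture is a finite sum of exponentials with rates among the
   alpha_{i,n}; the operators K_{oi} and B_0 act only on the coefficients. *)

(** * Inner products in a complex Hilbert space *)

Section HilbertSpace.
Context {R : realType} {H : hilbertSpace R}.
Implicit Types (a : R[i]) (x y z : H).

Lemma hdotC x y : hdot H x y = Num.conj (hdot H y x).
Proof. by rewrite hermC expr0 mul1r. Qed.

Lemma hdotZl a x y : hdot H (a *: x) y = a * hdot H x y.
Proof. by rewrite linearZl_LR. Qed.

Lemma hdotZr a x y : hdot H x (a *: y) = Num.conj a * hdot H x y.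
Proof. by rewrite hdotC hdotZl rmorphM [hdot H x y]hdotC. Qed.

Lemma hdotDl x y z : hdot H (x + y) z = hdot H x z + hdot H y z.
Proof. by rewrite linearDl. Qed.

Lemma hdotDr x y z : hdot H x (y + z) = hdot H x y + hdot H x z.
Proof. by rewrite linearDr. Qed.

(** Cauchy-Schwarz for a unit vector: with [c = hdot H x y], the squared norm of [x - c *: y] is the
    squared norm of [x] minus that of [c], and it is nonnegative. *)
Lemma norm_hdot_le x y : hdot H y y = 1 -> `|hdot H x y| <= `|x|.
Proof.
move=> y1; rewrite -(@ler_pXn2r _ 2) ?nnegrE ?normr_ge0//.
set c := hdot H x y.
have yx : hdot H y x = Num.conj c by rewrite hdotC.
have := exprn_ge0 2 (normr_ge0 (x + (- c) *: y)).
rewrite -hdot_norm hdotDl !hdotDr !hdotZl !hdotZr y1 yx -/c mulr1.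
rewrite rmorphN /= !mulNr mulrN opprK addNr addr0.
by rewrite -normCKC subr_ge0 hdot_norm.
Qed.
End HilbertSpace.

(** * Limits at 0 from the right, under bounded operators and in [R[i]] *)

Lemma near_right0_ex (R : realType) (P : set R) : (\forall h \near 0^'+, P h) ->
  exists2 d : R, 0 < d & forall h, 0 < h <= d -> P h.
Proof.
move=> /nbhs_ballP[d /= d0 dP]; exists (d / 2); first by rewrite divr_gt0.
move=> h /andP[h0 hd]; apply: dP => //=.
rewrite /ball /= sub0r normrN gtr0_norm// (le_lt_trans hd)//.
by rewrite ltr_pdivrMr// ltr_pMr// ltr1n.
Qed.

Lemma bounded_operator_cvg (R : realType) (V W : normedModType R[i])
    (T : {linear V -> W}) (U : Type) (F : set_system U) (FF : Filter F)
    (f : U -> V) (y : V) :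
  bounded_operator T -> f u @[u --> F] --> y -> T (f u) @[u --> F] --> T y.
Proof.
move=> [M TM] fy.
have cT : continuous T.
  apply/linear_bounded_continuous/linear_boundedP.
  exists M%:C; split; first by apply/complex_realP; exists M.
  by move=> r Mr x; apply: le_trans (TM x) _; rewrite ler_wpM2r// ltW.
exact: (cvg_comp _ _ fy (cT y)).
Qed.

(** A positive element of [R[i]] is real, so every tolerance in [R[i]] comes from one in [R]. *)
Lemma real_complex_cvg (R : realType) (U : Type) (F : set_system U)
    (FF : Filter F) (f : U -> R) (l : R) :
  f u @[u --> F] --> l -> ((f u)%:C : R[i]^o) @[u --> F] --> (l%:C : R[i]^o).
Proof.
move=> /cvgrPdist_lt fl; apply/cvgrPdist_lt => e e0.
have eE : e = (complex.Re e)%:C by rewrite RRe_real// gtr0_real.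
have /fl : 0 < complex.Re e by rewrite -ltcR -eE.
apply: filterS => u; rewrite -rmorphB /= normc_def /= expr0n addr0 sqrtr_sqr eE.
by rewrite ltcR.
Qed.

(** * Eigenspaces of a self-adjoint operator *)

Section Operator.
Context {R : realType} {H : hilbertSpace R} {A : unbounded_operator H}.
Implicit Types (a z : R[i]) (x y : H).

Lemma self_adjoint_sym x y : self_adjoint A -> op_dom A x -> op_dom A y ->
  hdot H (A x) y = hdot H x (A y).
Proof.
by move=> [_ sA] Ax Ay; have /sA : op_dom A y /\ A y = A y by []; apply.
Qed.

(** Unlike the set of eigenvectors it contains 0, which makes it a linear subspace. *)
Definition eigenspace z : set H := [set x | op_dom A x /\ A x = z *: x].

Lemma eigenspace_linear z a x y : eigenspace z x -> eigenspace z y ->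
  eigenspace z (a *: x + y).
Proof.
move=> [dx Ax] [dy Ay]; split; first exact: op_domP.
by rewrite op_linear// Ax Ay scalerDr !scalerA (mulrC a).
Qed.

(** Symmetry makes [hdot H (A x) y] equal to both [z] and [b] times [hdot H x y], as [b] is its own
    conjugate. *)
Lemma eigenspace_orthogonal z (b : R) x y : self_adjoint A -> z != b%:C ->
  eigenspace z x -> eigenspace b%:C y -> hdot H x y = 0.
Proof.
move=> sA zb [dx Ax] [dy Ay]; have := self_adjoint_sym _ _ sA dx dy.
rewrite Ax Ay hdotZl hdotZr (conj_Creal (_ : _ \is Num.real)); last first.
  by apply/complex_realP; exists b.
by move/eqP; rewrite -subr_eq0 -mulrBl mulf_eq0 subr_eq0 (negPf zb) => /eqP.
Qed.

Lemma orthonormal_basis_eq0 (phi : nat -> H) x : orthonormal_basis phi ->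
  (forall n, hdot H x (phi n) = 0) -> x = 0.
Proof.
move=> [_ /(_ x) cx] x0; apply: cvg_unique cx _ => //.
apply: cvg_near_cst; apply: nearW => m /=.
by apply: big1 => i _; rewrite x0 scale0r.
Qed.

Lemma eigenvalue_in_eigenbasis (phi : nat -> H) (alpha : nat -> R) z x :
  self_adjoint A -> orthonormal_eigenbasis A phi alpha -> eigenvector A z x ->
  exists n, z = (alpha n)%:C.
Proof.
move=> sA [bphi ephi] [dx /negP x0 Ax]; apply: contrapT => zn.
apply: x0; apply/eqP.
apply: orthonormal_basis_eq0 bphi _ => n.
apply: eigenspace_orthogonal sA _ (conj dx Ax) (_ : eigenspace (alpha n)%:C _).
  by apply/eqP => zE; apply: zn; exists n.
by have [] := ephi n.
Qed.

(** Coefficients of index at least [m] vanish by orthogonality, so the partial sums of the expansion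
    are constant from [m] on. *)
Lemma eigenspace_expansion (phi : nat -> H) (alpha : nat -> R) z m x :
  self_adjoint A -> orthonormal_eigenbasis A phi alpha ->
  (forall n, (m <= n)%N -> (alpha n)%:C != z) -> eigenspace z x ->
  x = \sum_(0 <= n < m) hdot H x (phi n) *: phi n.
Proof.
move=> sA [[_ /(_ x) cx] ephi] za ex; apply: cvg_unique cx _ => //.
apply: cvg_near_cst; exists m => //= n /= mn.
rewrite (big_cat_nat _ mn) //= [X in _ + X]big_nat_cond [X in _ + X]big1.
  by rewrite addr0.
move=> i /andP[/andP[mi _] _].
rewrite (eigenspace_orthogonal z (alpha i)) ?scale0r// 1?eq_sym ?za//.
by have [] := ephi i.
Qed.

(** * The semigroup on an eigenspace *)

Section Semigroup.
Context {S : R -> {linear H -> H}} (SA : is_exp_semigroup A S).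

(** The bounded operator [S t] commutes with difference quotients at 0, so those of [S t x] converge
    to [S t (- A x)]; the description of the generator then applies to [S t x]. *)
Lemma semigroup_eigenspace z t x : 0 <= t -> eigenspace z x ->
  eigenspace z (S t x).
Proof.
have [Sb _ SD _ SG] := SA.
move=> t0 [dx Ax].
have gx : S t ((h^-1)%:C *: (S h x - x)) @[h --> 0^'+] --> S t (- A x).
  by apply: bounded_operator_cvg; [exact: Sb | exact: (SG x (- A x)).2].
have : (h^-1)%:C *: (S h (S t x) - S t x) @[h --> 0^'+] --> - (z *: S t x).
  have -> : - (z *: S t x) = S t (- A x) by rewrite Ax -!scaleNr linearZ.
  apply: cvg_trans gx; apply: near_eq_cvg.
  near=> h; have h0 : 0 <= h by near: h; exact: nbhs_right_ge.
  by rewrite [S t (_ *: _)]linearZ [S t (_ - _)]linearB -!SD// [h + t]addrC.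
by move=> /SG[dSx] /oppr_inj.
Unshelve. all: by end_near. Qed.

(** Strong continuity at 0 brings the finitely many [S h (phi n)] within 1 of [phi n] for small [h],
    and the coefficients of [x] are at most the norm of [x]. *)
Lemma semigroup_locally_bounded (m : nat) (phi : nat -> H) (E : set H) :
  (forall n, hdot H (phi n) (phi n) = 1) ->
  (forall x, E x -> x = \sum_(0 <= n < m) hdot H x (phi n) *: phi n) ->
  exists2 M : R[i], 0 <= M & exists2 d : R, 0 < d &
    forall h x, 0 <= h <= d -> E x -> `|S h x| <= M * `|x|.
Proof.
have [_ S0 _ Sc _] := SA.
move=> phi1 Ephi; pose M : R[i] := \sum_(0 <= n < m) (`|phi n| + 1).
exists M; first by apply: sumr_ge0 => n _; rewrite addr_ge0.
have : \forall h \near 0^'+, forall n : 'I_m, `|S h (phi n)| <= `|phi n| + 1.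
  apply: filter_forall => n.
  have /cvgrPdist_lt/(_ 1 ltr01) := Sc (phi n); apply: filterS => h /ltW hn.
  rewrite -[S h _](addKr (- phi n)) opprK (le_trans (ler_normD _ _))// lerD2l.
  by rewrite addrC distrC.
move=> /near_right0_ex[d d0 dP]; exists d => //.
move=> h x /andP[h0 hd] Ex; rewrite {1}(Ephi x Ex) linear_sum /=.
apply: le_trans (ler_norm_sum _ _ _) _; rewrite mulr_suml.
rewrite big_nat [leRHS]big_nat; apply: ler_sum => n /andP[_ nm].
rewrite linearZ normrZ mulrC ler_pM//; last exact: norm_hdot_le.
(* The filter [0^'+] says nothing at 0 itself, where the semigroup is the identity. *)
have [->|h1] := eqVneq h 0; first by rewrite S0 lerDl.
by apply: (dP h _ (Ordinal nm)); rewrite lt_neqAle eq_sym h1 h0.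
Qed.

(** Both orbits start at [x] with right derivative [- b *: x], so they differ by o(h). *)
Lemma semigroup_eigen_defect (b : R) x : eigenspace b%:C x ->
  (h^-1)%:C *: (S h x - (expR (- b * h))%:C *: x) @[h --> 0^'+] --> (0 : H).
Proof.
have [_ _ _ _ SG] := SA.
move=> [dx Ax]; have gx := (SG x (- A x)).2 (conj dx erefl).
have : h^-1 * (expR (- b * h) - 1) @[h --> 0^'+] --> - b.
  have : is_derive (0 : R) 1 (expR \o (fun h => - b * h))
      (expR (- b * 0) * - b).
    apply: is_derive1_comp.
    by have := is_deriveZ (- b) (@is_derive_id R R 0 1); rewrite scaler1.
  rewrite mulr0 expR0 mul1r => -[dE vE].
  have : h^-1 * (expR (- b * h) - 1) @[h --> 0^'] --> - b.
    rewrite -[X in _ --> X]vE; apply: cvg_trans dE; apply: near_eq_cvg.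
    apply: nearW => h /=.
    by rewrite [_%:A]mulr1 addr0 mulr0 expR0.
  by apply: cvg_dnbhs_at_right.
move=> /real_complex_cvg ec.
have gd := cvgB gx (cvgZr_tmp (a := x) ec).
rewrite Ax rmorphN scaleNr subrr in gd.
apply: cvg_trans (gd _ _); apply: near_eq_cvg; apply: nearW => h /=.
rewrite [LHS](_ : _ = (h^-1)%:C *: (S h x - x) -
  (h^-1 * (expR (- b * h) - 1))%:C *: x)//.
rewrite rmorphM rmorphB -scalerA -scalerBr scalerBl scale1r opprB.
by rewrite addrA subrK.
Qed.

(** Replacing the steps of the semigroup one by one by multiplication by [c] leaves [n] errors, each
    a power of [c] times some [S (h *+ k)] applied to the one-step defect; that power is at most
    1. *)
Lemma semigroup_telescope (E : set H) (M c : R[i]) (h : R) x (n : nat) :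
  0 <= h -> 0 <= M -> 0 <= c -> c <= 1 -> E (S h x - c *: x) ->
  (forall k y, (k < n)%N -> E y -> `|S (h *+ k) y| <= M * `|y|) ->
  `|S (h *+ n) x - c ^+ n *: x| <= M * `|S h x - c *: x| *+ n.
Proof.
have [_ S0 SD _ _] := SA.
move=> h0 M0 c0 c1 Ex; elim: n => [|n IH] SM.
  by rewrite !mulr0n expr0 S0 scale1r subrr normr0.
have -> : S (h *+ n.+1) x - c ^+ n.+1 *: x =
    S (h *+ n) (S h x - c *: x) + c *: (S (h *+ n) x - c ^+ n *: x).
  rewrite [S _ (_ - _)]linearB [S _ (_ *: _)]linearZ /= -SD ?mulrn_wge0//.
  by rewrite -mulrSr scalerBr scalerA exprS addrA subrK.
rewrite (le_trans (ler_normD _ _))// mulrS lerD//; first exact: SM.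
rewrite normrZ ger0_norm// (le_trans _ (IH _))//; first by rewrite ler_piMl.
by move=> k y kn; apply: SM; exact: ltnW.
Qed.

(** With [n] steps of length [t / n] the one-step defect is at most [e * t / n], so the telescoped
    error is at most [M * t * e] for arbitrarily small [e]. The condition [t <= d] keeps all
    intermediate times where [M] is a bound. *)
Lemma semigroup_exp_small (b d : R) (M : R[i]) x t :
  0 <= b -> 0 <= M -> eigenspace b%:C x ->
  (forall h y, 0 <= h <= d -> eigenspace b%:C y -> `|S h y| <= M * `|y|) ->
  0 < t <= d -> S t x = (expR (- b * t))%:C *: x.
Proof.
move=> b0 M0 Ex SM /andP[t0 td]; apply/eqP; rewrite -subr_eq0 -normr_eq0.
set r := `|_|; apply: contraT => rN0.
have r0 : 0 < r by rewrite lt_def rN0 normr_ge0.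
have t0C : 0 < t%:C :> R[i] by rewrite (ltcR 0).
have Mt0 : 0 < M * t%:C + 1 by rewrite ltr_wpDl// mulr_ge0// ltW.
(* This tolerance makes [M * t * e] smaller than [r], contradicting the telescoped bound; the
   summand 1 keeps the denominator positive. *)
pose e := r / (M * t%:C + 1).
have e0 : 0 < e by rewrite divr_gt0.
suff : r <= M * t%:C * e.
  by rewrite /e mulrCA ler_pMr// ler_pdivlMr// mul1r gerDl ler10.
have /cvgrPdist_lt/(_ e e0)/near_right0_ex[h0 h00 De] :=
  semigroup_eigen_defect b x Ex.
(* [n] exceeds [t / h0], so the step [t / n] is at most [h0]. *)
pose n := (Num.truncn (t / h0)).+1.
have n0 : 0 < n%:R :> R by rewrite ltr0n.
pose h := t / n%:R.
have hn : h *+ n = t by rewrite -mulr_natr divfK// gt_eqF.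
have hgt0 : 0 < h by rewrite divr_gt0.
have hle : h <= h0.
  rewrite ler_pdivrMr// mulrC -ler_pdivrMr// ltW//.
  by have /andP[] := truncn_itv (divr_ge0 (ltW t0) (ltW h00)).
have {}De : `|S h x - (expR (- b * h))%:C *: x| <= h%:C * e.
  have := De h; rewrite hgt0 hle => /(_ erefl) /ltW.
  rewrite sub0r normrN normrZ gtr0_norm ?(ltcR 0) ?invr_gt0// fmorphV /=.
  by rewrite ler_pdivrMl// (ltcR 0).
have cE : (expR (- b * t))%:C = (expR (- b * h))%:C ^+ n :> R[i].
  by rewrite -rmorphXn -expRM_natr -mulrA mulr_natr hn.
rewrite /r cE -hn.
apply: le_trans (semigroup_telescope (eigenspace b%:C) M _ h x n _ _ _ _ _ _) _
  => //.
- exact: ltW.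
- by rewrite ler0c expR_ge0.
- rewrite -[1]/(1%:C) lecR -[leRHS]expR0 ler_expR mulNr oppr_le0.
  by rewrite mulr_ge0// ltW.
(* The defect stays in the eigenspace, where the bound [M] holds, because [S h] preserves it. *)
- rewrite addrC -scaleNr; apply: eigenspace_linear => //.
  by apply: semigroup_eigenspace => //; exact: ltW.
- move=> k y kn Ey; apply: SM => //.
  rewrite (mulrn_wge0 _ (ltW hgt0)) (le_trans _ td)// -hn.
  by apply: ler_wpMn2l; [exact: ltW | exact: ltnW].
rewrite hn -mulrnAr -mulrA ler_wpM2l// -hn rmorphMn /= mulrnAl lerMn2r De.
by rewrite orbT.
Qed.

(** A larger [t] is cut into equal steps of length at most [d]; the semigroup law multiplies the
    exponential factors. *)
Lemma semigroup_exp (b d : R) (M : R[i]) x t :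
  0 <= b -> 0 <= M -> 0 < d -> eigenspace b%:C x ->
  (forall h y, 0 <= h <= d -> eigenspace b%:C y -> `|S h y| <= M * `|y|) ->
  0 <= t -> S t x = (expR (- b * t))%:C *: x.
Proof.
have [_ S0 SD _ _] := SA.
move=> b0 M0 d0 Ex SM; rewrite le_eqVlt => /predU1P[<-|t0].
  by rewrite S0 mulr0 expR0 scale1r.
pose n := (Num.truncn (t / d)).+1; pose h := t / n%:R.
have n0 : 0 < n%:R :> R by rewrite ltr0n.
have hn : h *+ n = t by rewrite -mulr_natr divfK// gt_eqF.
have hgt0 : 0 < h by rewrite divr_gt0.
have hle : h <= d.
  rewrite ler_pdivrMr// mulrC -ler_pdivrMr// ltW//.
  by have /andP[] := truncn_itv (divr_ge0 (ltW t0) (ltW d0)).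
have Sh : S h x = (expR (- b * h))%:C *: x.
  by apply: (semigroup_exp_small b d M) => //; rewrite hgt0.
suff expn k : S (h *+ k) x = (expR (- b * (h *+ k)))%:C *: x.
  by rewrite -hn expn.
elim: k => [|k IH]; first by rewrite S0 mulr0 expR0 scale1r.
rewrite mulrS SD ?mulrn_wge0 ?ltW// IH [S h _]linearZ /= Sh.
by rewrite scalerA -rmorphM mulrC -expRD -mulrDr.
Qed.
End Semigroup.

Lemma semigroup_eigenvector S (phi : nat -> H) (alpha : nat -> R) :
  is_exp_semigroup A S -> self_adjoint A ->
  orthonormal_eigenbasis A phi alpha ->
  (forall n, 0 < alpha n) -> alpha n @[n --> \oo] --> +oo ->
  forall z x, eigenvector A z x -> exists2 b : R, 0 < b &
    forall t, 0 <= t -> S t x = (expR (- b * t))%:C *: x.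
Proof.
move=> SA sA bA a0 aoo z x zx.
have [n zE] := eigenvalue_in_eigenbasis phi alpha z x sA bA zx.
exists (alpha n) => // t t0.
(* From some index on, [alpha] exceeds [alpha n], so finitely many basis vectors span the
   eigenspace. *)
have [m _ mP] : \forall k \near \oo, (alpha k)%:C != (alpha n)%:C :> R[i].
  have /cvgryPgt/(_ (alpha n)) := aoo; apply: filterS => k nk.
  by apply/eqP => /complexI nE; rewrite nE ltxx in nk.
have phi1 k : hdot H (phi k) (phi k) = 1 by case: bA => -[-> _] _; rewrite eqxx.
have [M M0 [d d0 SM]] := semigroup_locally_bounded SA m phi
  (eigenspace (alpha n)%:C) phi1
  (fun y => eigenspace_expansion phi alpha _ m y sA bA mP).
apply: (semigroup_exp SA (alpha n) d M) => //; first exact: ltW.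
by case: zx => ? _; rewrite zE.
Qed.

End Operator.

(** * Finite sums of decaying exponentials *)

Section ExponentialSums.
Context {R : realType}.

(** Rates may repeat in the list, so that adding functions is just concatenation. *)
Definition exponential_sum (f : R -> R[i]) :=
  exists s : seq (R * R[i]), (forall p, p \in s -> 0 < p.1) /\
    forall t, 0 <= t -> f t = \sum_(p <- s) p.2 * (expR (- p.1 * t))%:C.

Lemma exponential_sum_sum n (f : 'I_n -> R -> R[i]) :
  (forall i, exponential_sum (f i)) ->
  exponential_sum (fun t => \sum_(i < n) f i t).
Proof.
elim: n f => [|n IH] f fE.
  by exists [::]; split=> // t _; rewrite big_ord0 big_nil.
have [s1 [s1p s1E]] := IH _ (fun i => fE (widen_ord (leqnSn n) i)).
have [s2 [s2p s2E]] := fE ord_max.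
exists (s1 ++ s2); split=> [p|t t0].
  by rewrite mem_cat => /orP[/s1p|/s2p].
by rewrite big_cat big_ord_recr /= s1E// s2E.
Qed.

Lemma exponential_sum_merge (f : R -> R[i]) : exponential_sum f ->
  exists (L : nat) (mu : 'I_L -> R) (a : 'I_L -> R[i]),
    [/\ forall l : 'I_L, 0 < mu l, injective mu
      & forall t : R, 0 <= t ->
          f t = \sum_(l < L) a l * (expR (- mu l * t))%:C].
Proof.
move=> [s [s0 fE]]; pose r := undup [seq p.1 | p <- s].
exists (size r), (fun l => r`_l), (fun l => \sum_(p <- s | p.1 == r`_l) p.2).
split.
- move=> l; have : r`_l \in r by exact: mem_nth.
  by rewrite mem_undup => /mapP[p /s0 p0 ->].
- by move=> k l /eqP; rewrite nth_uniq ?undup_uniq// => /eqP /val_inj.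
move=> t t0; rewrite fE//.
rewrite [RHS](eq_bigr (fun l : 'I_(size r) =>
  \sum_(p <- s) if p.1 == r`_l then p.2 * (expR (- p.1 * t))%:C else 0));
  last first.
  by move=> l _; rewrite mulr_suml -big_mkcond; apply: eq_bigr => p /eqP ->.
(* Once the sums are exchanged, each pair [p] contributes for exactly one [l], the position of its
   rate in [r]. *)
rewrite exchange_big /= big_seq [RHS]big_seq; apply: eq_bigr => p ps.
have pr : (index p.1 r < size r)%N by rewrite index_mem mem_undup map_f.
rewrite (bigD1 (Ordinal pr))//= nth_index -?index_mem// eqxx big1 ?addr0//.
move=> l lp; case: eqP => // pl; case/eqP: lp; apply: val_inj => /=.
by rewrite pl index_uniq ?undup_uniq.
Qed.
End ExponentialSums.

(** * The mixture observable as an exponential sum *)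

Theorem corollary4p2 (R : realType) (I : Type) (H : I -> hilbertSpace R)
  (A : forall i : I, unbounded_operator (H i))
  (S : forall i : I, R -> {linear H i -> H i})
  (K : forall i j : I, {linear H j -> H i})
  (lambda : I -> I -> R)
  (Hsep : forall i : I, separable (H i))
  (Asa : forall i : I, self_adjoint (A i))
  (Apos : forall i : I, positive_operator (A i))
  (Acr : forall i : I, has_compact_resolvent (A i))
  (Aeig : forall i : I, exists (a : R) (x : H i),
      0 < a /\ eigenvector (A i) a%:C x)
  (SE : forall i : I, is_exp_semigroup (A i) (S i))
  (Kbounded : forall i j : I, bounded_operator (K i j))
  (Kinj : forall i j : I, injective (K i j))
  (lambda_gt0 : forall i j : I, 0 < lambda i j)
  (Kcomp : forall (i j k : I) (x : H k), K i k x = K i j (K j k x))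
  (Kintertwine : forall (i j : I) (t : R) (x : H j), 0 <= t ->
      K i j (S j t x) = S i (lambda i j * t) (K i j x))
  (o : I) (B0 : {linear H o -> R[i]^o}) (B0bounded : bounded_operator B0)
  (N : nat) (idx : 'I_N -> I) (idx_inj : injective idx)
  (psi : forall k : 'I_N, H (idx k))
  (w : 'I_N -> R) (w_gt0 : forall k : 'I_N, 0 < w k)
  (phi : forall k : 'I_N, nat -> H (idx k)) (alpha : 'I_N -> nat -> R)
  (phi_basis : forall k : 'I_N,
      orthonormal_eigenbasis (A (idx k)) (phi k) (alpha k))
  (alpha_gt0 : forall (k : 'I_N) (n : nat), 0 < alpha k n)
  (alpha_infty : forall k : 'I_N, alpha k n @[n --> \oo] --> +oo)
  (psi_finite : forall k : 'I_N,
      finite_spectral_support (A (idx k)) (psi k)) :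
  exists (L : nat) (mu : 'I_L -> R) (a : 'I_L -> R[i]),
    [/\ forall l : 'I_L, 0 < mu l,
        injective mu
      & forall t : R, 0 <= t ->
          mixture S K B0 psi w t
          = \sum_(l < L) a l * (expR (- mu l * t))%:C].
Proof.
apply: exponential_sum_merge; apply: exponential_sum_sum => k.
have [m [c [z [v [zv ->]]]]] := psi_finite k.
pose g (j : 'I_m) t : R[i] :=
  (w k)%:C *: B0 (K o (idx k) (S (idx k) t (c j *: v j))).
suff [s [s0 sE]] : exponential_sum (fun t => \sum_(j < m) g j t).
  exists s; split=> // t t0; rewrite -sE//.
  by rewrite 3!linear_sum scaler_sumr.
apply: exponential_sum_sum => j.
have [b b0 Sb] := semigroup_eigenvector _ _ _ (SE (idx k)) (Asa _)
  (phi_basis k) (alpha_gt0 k) (alpha_infty k) _ _ (zv j).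
(* The semigroup acts before [K] and [B0], which therefore enter only the coefficient of a single
   exponential. *)
exists [:: (b, (w k)%:C * (c j * B0 (K o (idx k) (v j))))]; split=> [p|t t0].
  by rewrite inE => /eqP ->.
rewrite big_seq1 /g [S _ t _]linearZ /= Sb// scalerA.
rewrite [K _ _ _]linearZ [B0 _]linearZ /=.
by rewrite /GRing.scale /= -!mulrA [X in c j * X]mulrC.
Qed.
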